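(* Let $n \ge 1$ and let $\Phi, \Psi : [0,\infty) \to [0,\infty)$ be Young functions. Then the following statements are equivalent: (1) There exists a constant $C>0$ such that $\Phi(t) \leq \Psi(Ct)$ for every $t > 0$. (2) $wL_{\Psi}(\mathbb{R}^n) \subseteq wL_{\Phi}(\mathbb{R}^n)$. (3) There exists a constant $C>0$ such that $\| f \|_{wL_\Phi(\mathbb{R}^n)} \leq C \| f \|_{wL_\Psi(\mathbb{R}^n)}$ for every $f \in wL_{\Psi}(\mathbb{R}^n)$.
   Context: A Young function is a function $\Phi:[0,\infty)\to[0,\infty)$ that is convex, left-continuous, with $\Phi(0)=0$ and $\lim_{t\to\infty}\Phi(t)=\infty$. $|E|$ denotes the Lebesgue measure of a measurable set $E\subseteq\mathbb{R}^n$. The weak Orlicz space $wL_\Phi(\mathbb{R}^n)$ is the set of measurable functions $f:\mathbb{R}^n\to\mathbb{R}$ such that $\|f\|_{wL_\Phi(\mathbb{R}^n)}<\infty$, where $$\|f\|_{wL_\Phi(\mathbb{R}^n)} := \inf\left\{b>0 : \sup_{t>0}\Phi(t)\,\left|\left\{x\in\mathbb{R}^n : \frac{|f(x)|}{b}>t\right\}\right|\le 1\right\},$$ with the conventions $\inf\emptyset=\infty$ and $0\cdot\infty=0$. Functions equal almost everywhere are identified. *)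

(* Defs.v *)
From HB Require Import structures.
From mathcomp Require Import all_boot all_order all_algebra.
From mathcomp Require Import all_classical all_reals all_analysis.
Set Implicit Arguments.
Unset Strict Implicit.
Unset Printing Implicit Defensive.
Import Order.TTheory GRing.Theory Num.Theory numFieldNormedType.Exports.
Local Open Scope classical_set_scope.
Local Open Scope ring_scope.

(* As a measurable type, this carries the Borel (product) sigma-algebra. *)
Notation Rn R n := (n.-tuple (measurableTypeR R)).

Section lebesgue_cons.
Context (R : realType) (n : nat).
Variable mu : {sigma_finite_measure set (Rn R n) -> \bar R}.

Definition tcons (p : measurableTypeR R * Rn R n) : Rn R n.+1 :=
  [the n.+1.-tuple _ of p.1 :: p.2].

Lemma measurable_tcons : measurable_fun setT tcons.
Proof. exact: measurable_cons. Qed.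

(* The product of the one-dimensional Lebesgue measure with mu, carried to
   R^(n+1) by (x, t) |-> x :: t. *)
Definition lebesgue_cons : set (Rn R n.+1) -> \bar R :=
  pushforward (@lebesgue_measure R \x mu)%E tcons.

Let pf := measure_function_pushforward__canonical__measure_function_Measure
  (@lebesgue_measure R \x mu)%E measurable_tcons.

Let lebesgue_cons0 : lebesgue_cons set0 = 0%E.
Proof. exact: (measure0 pf). Qed.

Let lebesgue_cons_ge0 A : (0 <= lebesgue_cons A)%E.
Proof. exact: (measure_ge0 pf). Qed.

Let lebesgue_cons_sigma_additive : semi_sigma_additive lebesgue_cons.
Proof. exact: (@measure_semi_sigma_additive _ _ _ pf). Qed.

HB.instance Definition _ := isMeasure.Build _ _ _ lebesgue_cons
  lebesgue_cons0 lebesgue_cons_ge0 lebesgue_cons_sigma_additive.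

Lemma lebesgue_consE (A : set R) (B : set (Rn R n)) :
  measurable (A : set (measurableTypeR R)) -> measurable B ->
  lebesgue_cons [set t | A (thead t) /\ B [tuple of behead t]] =
  (@lebesgue_measure R A * mu B)%E.
Proof.
move=> mA mB; rewrite -product_measure1E//; congr (product_measure1 _ _ _).
apply/seteqP; split=> -[x t]/=;
  by rewrite (_ : [tuple of behead (tcons (x, t))] = t)//; exact/val_inj.
Qed.

Let lebesgue_cons_sigma_finite : sigma_finite setT lebesgue_cons.
Proof.
have /sigma_finiteP[F [TF ndF Foo]] := sigma_finiteT (@lebesgue_measure R).
have /sigma_finiteP[G [TG ndG Goo]] := sigma_finiteT mu.
exists (fun k => [set t | F k (thead t) /\ G k [tuple of behead t]]).
  apply/esym/seteqP; split=> // t _.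
  have [i _ Fi] : (\bigcup_k F k) (thead t) by rewrite -TF.
  have [j _ Gj] : (\bigcup_k G k) [tuple of behead t] by rewrite -TG.
  exists (maxn i j) => //; split.
  - by move: Fi; exact/subsetPset/ndF/leq_maxl.
  - by move: Gj; exact/subsetPset/ndG/leq_maxr.
move=> k; have [mF Fk] := Foo k; have [mG Gk] := Goo k; split.
  apply: measurableI.
  - by rewrite -[X in measurable X]setTI; exact: measurable_tnth.
  - by rewrite -[X in measurable X]setTI; exact: measurable_behead.
by rewrite lebesgue_consE// lte_mul_pinfty// ge0_fin_numE.
Qed.

HB.instance Definition _ := Measure_isSigmaFinite.Build _ _ _
  lebesgue_cons lebesgue_cons_sigma_finite.

End lebesgue_cons.

(* The n-fold product of the one-dimensional Lebesgue measure, on the Borel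
   sigma-algebra of R^n. *)
Fixpoint borel_lebesgue (R : realType) (n : nat) :
    {sigma_finite_measure set (Rn R n) -> \bar R} :=
  match n with
  | 0 => [the sigma_finite_measure _ _ of \d_([tuple] : Rn R 0)]
  | m.+1 => [the sigma_finite_measure _ _ of lebesgue_cons (borel_lebesgue R m)]
  end.

(* R^n with the sigma-algebra of Lebesgue-measurable sets, i.e. the completion
   of the Borel sigma-algebra, given by Caratheodory's criterion. *)
Definition lebesgueRn_type (R : realType) (n : nat) : measurableType _ :=
  caratheodory_type ((borel_lebesgue R n)^*)%mu.

Definition lebesgueRn (R : realType) (n : nat) :
    set (lebesgueRn_type R n) -> \bar R :=
  @completed_measure_extension _ _ _ (borel_lebesgue R n).

HB.instance Definition _ (R : realType) (n : nat) :=
  Measure.on (@lebesgueRn R n).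

Lemma lebesgueRn_borelE (R : realType) (n : nat) (A : set (Rn R n)) :
  measurable A -> lebesgueRn A = borel_lebesgue R n A.
Proof. exact: measurable_mu_extE. Qed.

Lemma measurable_tbox (R : realType) (n : nat) (A : 'I_n -> set R) :
  (forall i, measurable (A i : set (measurableTypeR R))) ->
  measurable [set t : Rn R n | forall i, A i (tnth t i)].
Proof.
move=> mA; rewrite (_ : [set t | _] =
    \bigcap_(i in [set: 'I_n]) ((@tnth _ _)^~ i @^-1` A i)); last first.
  by apply/seteqP; split=> t /= At i => [_|]; exact: At.
apply: fin_bigcap_measurable => // i _.
by rewrite -[X in measurable X]setTI; exact: measurable_tnth.
Qed.

Lemma lebesgueRn_tbox (R : realType) (n : nat) (A : 'I_n -> set R) :
  (forall i, measurable (A i : set (measurableTypeR R))) ->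
  lebesgueRn [set t : Rn R n | forall i, A i (tnth t i)] =
  \big[*%E/1%E]_(i < n) @lebesgue_measure R (A i).
Proof.
move=> mA; rewrite (lebesgueRn_borelE (measurable_tbox mA)).
elim: n => [|n IHn] in A mA *.
  by rewrite big_ord0 /= diracE mem_set// => -[].
have mA' i : measurable (A (lift ord0 i) : set (measurableTypeR R)) by [].
rewrite big_ord_recl -(IHn _ mA')/= -(lebesgue_consE _ _ (measurable_tbox mA'))//.
congr (lebesgue_cons _ _); apply/seteqP; split=> t /=.
  move=> At; split=> [|i]; first exact: At.
  by have := At (lift ord0 i); rewrite {1}(tuple_eta t) tnthS.
move=> [A0 At] i; have [j ->|->] := unliftP ord0 i; last exact: A0.
by rewrite (tuple_eta t) tnthS; exact: At.
Qed.

(* Functions on [0, +oo[ are represented by functions on R of which only the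
   values on [0, +oo[ are constrained and used. *)
Record young_function (R : realType) (Phi : R -> R) : Prop := {
  young_ge0 : forall t, 0 <= t -> 0 <= Phi t ;
  young_convex : convex_function (`[0, +oo[%classic : set R) Phi ;
  young_left_continuous : forall t, 0 < t -> Phi x @[x --> t^'-] --> Phi t ;
  young0 : Phi 0 = 0 ;
  young_cvgy : Phi t @[t --> +oo] --> +oo
}.

Section weak_orlicz.
Context (R : realType) (n : nat).
Local Open Scope ereal_scope.

Definition weak_orlicz_norm (Phi : R -> R) (f : lebesgueRn_type R n -> R) :
    \bar R :=
  ereal_inf [set b%:E | b in [set b : R | (0 < b)%R /\
    ereal_sup [set (Phi t)%:E * lebesgueRn [set x | (t < `|f x| / b)%R]
              | t in [set t : R | (0 < t)%R]] <= 1]].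

(* The elements are functions rather than classes modulo equality almost
   everywhere; membership and norm respect that equality, see
   weak_orlicz_norm_ae and weak_orlicz_ae. *)
Definition weak_orlicz (Phi : R -> R) : set (lebesgueRn_type R n -> R) :=
  [set f | measurable_fun [set: lebesgueRn_type R n] f /\
           weak_orlicz_norm Phi f < +oo].

End weak_orlicz.
Arguments weak_orlicz {R} n Phi.

Section weak_orlicz_ae.
Context (R : realType) (n : nat) (Phi : R -> R).
Implicit Types f g h k : lebesgueRn_type R n -> R.

Lemma weak_orlicz_norm_ae f g : {ae @lebesgueRn R n, forall x, f x = g x} ->
  weak_orlicz_norm Phi f = weak_orlicz_norm Phi g.
Proof.
move=> [N [mN N0 fgN]].
have le h k (b t : R) : (forall x, ~ N x -> h x = k x) ->
    (lebesgueRn [set x | (t < `|h x| / b)%R] <=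
     lebesgueRn [set x | (t < `|k x| / b)%R])%E.
  move=> hk; rewrite -[leRHS]adde0 -N0.
  apply: le_trans (outer_measureU2 ((borel_lebesgue R n)^*)%mu _ _).
  apply: le_outer_measure => x /= tx.
  by have [|/hk<-] := pselect (N x); [right|left].
have fg x : ~ N x -> f x = g x by apply: contra_notP => /fgN.
rewrite /weak_orlicz_norm; congr (ereal_inf [set _ | _ in _]).
apply/funext => b; congr (_ /\ (ereal_sup [set _ | _ in _] <= _)%E).
apply/funext => t; congr (_ * _)%E.
by apply/eqP; rewrite eq_le; apply/andP; split; apply: le => x /fg ->.
Qed.

Lemma weak_orlicz_ae f g : {ae @lebesgueRn R n, forall x, f x = g x} ->
  weak_orlicz n Phi f -> weak_orlicz n Phi g.
Proof.
move=> fg [mf foo]; split; last by rewrite -(weak_orlicz_norm_ae fg).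
have [N [mN N0 fgN]] := fg.
have {}fg x : ~ N x -> f x = g x by apply: contra_notP => /fgN.
move=> _ B mB; rewrite setTI.
rewrite (_ : g @^-1` B = (f @^-1` B `\` N) `|` (g @^-1` B `&` N)).
  apply: measurableU.
    by apply: measurableD => //; rewrite -[X in measurable X]setTI; exact: mf.
  by apply: measure_is_complete_caratheodory; exists N; split=> // x [].
apply/seteqP; split=> x /=.
  by move=> Bx; have [|Nx] := pselect (N x); [right|left; rewrite fg].
by move=> [[+ /fg <-]//|[]].
Qed.
End weak_orlicz_ae.

(* Main.v *)
Require Import Defs.
From HB Require Import structures.
From mathcomp Require Import all_boot all_order all_algebra.
From mathcomp Require Import all_classical all_reals all_analysis.
From mathcomp Require Import measurable_realfun.
Set Implicit Arguments.
Unset Strict Implicit.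
Unset Printing Implicit Defensive.
Import Order.TTheory GRing.Theory Num.Theory numFieldNormedType.Exports.
Local Open Scope classical_set_scope.
Local Open Scope ring_scope.

(* The implication (1) => (3) is a rescaling of the level sets, and (3) => (2) is
   immediate. For (2) => (1), transporting the generalized inverse of Psi to a
   strip of R^n with cross-section of measure 1 gives a function f whose
   distribution function is 1 / Psi (up to right limits); hence f belongs to
   wL_Psi, and the weak-type bound expressing that f belongs to wL_Phi says
   precisely that Phi(t) is at most Psi(2bt). *)

(** Convexity between [t] and 0, where [Psi] vanishes, gives [Psi s <= s / t * Psi t], and
    [s / t <= 1]. *)
Lemma young_le (R : realType) (Psi : R -> R) (s t : R) :
  young_function Psi -> 0 <= s -> s <= t -> Psi s <= Psi t.
Proof.
move=> Y s0 st; have [t0|t0] := leP t 0.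
  by have /eqP -> : s == t by rewrite eq_le st (le_trans t0).
have q0 : 0 <= s / t by rewrite divr_ge0// ltW.
have q1 : s / t <= 1 by rewrite ler_pdivrMr// mul1r.
have := young_convex Y (Itv01 q0 q1).
move=> /(_ t 0); rewrite !inE/= !in_itv/= !andbT lexx (ltW t0).
move=> /(_ isT isT); rewrite convRE/= (young0 Y) mulr0 addr0.
have -> : conv (Itv01 q0 q1) (t : convex_lmodType R^o) 0 = s.
  by rewrite [LHS]convRE/= mulr0 addr0 divfK// gt_eqF.
move/le_trans; apply.
by rewrite ler_piMl// (young_ge0 Y)// ltW.
Qed.

(** * Generalized inverse of a Young function *)

Section generalized_inverse.
Context (R : realType) (Psi : R -> R).
Hypothesis Psi_young : young_function Psi.
Implicit Types s t u : R.

(* The generalized inverse of Psi at 1 / s. *)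
Definition young_inv s : R := sup [set t | 0 <= t /\ s * Psi t < 1].

(** The set contains 0, and since [Psi] tends to infinity it is bounded by any [M] past which [Psi]
    is at least [s^-1]. *)
Lemma young_inv_has_sup s : 0 < s ->
  has_sup [set t | 0 <= t /\ s * Psi t < 1].
Proof.
move=> s0; split; first by exists 0; rewrite /= (young0 Psi_young) mulr0.
have /cvgryPge/(_ s^-1)[M [_ MPsi]] := young_cvgy Psi_young.
exists M => t [_]; apply: contraTT; rewrite -ltNge -leNgt => /MPsi.
by rewrite -ler_pdivrMl// mulr1.
Qed.

Lemma young_inv_ge0 s : 0 < s -> 0 <= young_inv s.
Proof.
move=> s0; apply: sup_upper_bound; first exact: young_inv_has_sup.
by rewrite /= (young0 Psi_young) mulr0.
Qed.

(** Some member of the set exceeds [t], and [Psi] is monotone. Together with [young_inv_ge] this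
    inverts [Psi] up to the boundary case [t = young_inv s], which is left open. *)
Lemma lt_young_inv s t : 0 < s -> 0 <= t -> t < young_inv s ->
  s * Psi t < 1.
Proof.
move=> s0 t0 /(sup_gt (young_inv_has_sup s0).1)[u [u0 su] tu].
apply: le_lt_trans su; rewrite ler_pM2l//.
exact: (young_le Psi_young t0 (ltW tu)).
Qed.

Lemma young_inv_ge s t : 0 < s -> 0 <= t -> s * Psi t < 1 ->
  t <= young_inv s.
Proof.
by move=> s0 t0 st; apply: sup_upper_bound => //; exact: young_inv_has_sup.
Qed.

Lemma young_inv_le s t : 0 < s -> s <= t -> young_inv t <= young_inv s.
Proof.
move=> s0 st; have t0 := lt_le_trans s0 st.
apply: ge_sup; first exact: (young_inv_has_sup t0).1.
move=> u [u0 tu]; apply: young_inv_ge => //; apply: le_lt_trans tu.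
by rewrite ler_wpM2r// (young_ge0 Psi_young).
Qed.

(** [young_inv] is nonincreasing on the positive half-line, so this set is an interval. *)
Lemma measurable_young_inv_gt t :
  measurable ([set s | 0 < s /\ t < young_inv s] : set (measurableTypeR R)).
Proof.
apply: is_interval_measurable => s s' /= [s0 _] [_ ts'] u /andP[su us'].
have u0 := lt_le_trans s0 su.
by split=> //; apply: lt_le_trans ts' _; exact: young_inv_le.
Qed.

End generalized_inverse.

(** * Lengths of the intervals cut out by [s * c < 1] *)

Section hyperbola.
Context (R : realType).
Local Open Scope ereal_scope.

Lemma hyperbola_itv (c : R) : (0 < c)%R ->
  [set s : R | (0 < s /\ s * c < 1)%R] = `]0%R, c^-1%R[%classic.
Proof.
move=> c0; apply/seteqP; split=> s /=; rewrite in_itv/= -[(c^-1)%R]mul1r.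
  by rewrite ltr_pdivlMr// => -[-> ->].
by rewrite ltr_pdivlMr// => /andP[].
Qed.

Lemma measurable_hyperbola (c : R) : (0 <= c)%R ->
  measurable ([set s | (0 < s /\ s * c < 1)%R] : set (measurableTypeR R)).
Proof.
rewrite le_eqVlt => /predU1P[<-|/hyperbola_itv ->//].
rewrite (_ : [set _ | _] = `]0%R, +oo[%classic)//.
by apply/seteqP; split=> s /=; rewrite in_itv/= andbT mulr0 => // -[].
Qed.

(** This trades a weak-type bound for a pointwise inequality. The set has length [c^-1], or [+oo]
    when [c] is 0, a case that arises because a Young function may vanish near 0; there the
    convention that 0 times [+oo] is 0 keeps the equivalence true. *)
Lemma mule_hyperbola_le1 (a c : R) : (0 <= c)%R ->
  (a%:E * lebesgue_measure [set s : R | (0 < s /\ s * c < 1)%R] <= 1) =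
  (a <= c)%R.
Proof.
rewrite le_eqVlt => /predU1P[<-|c0].
  rewrite (_ : [set _ | _] = `]0%R, +oo[%classic); last first.
    by apply/seteqP; split=> s /=; rewrite in_itv/= andbT mulr0 => // -[].
  rewrite lebesgue_measure_itv/= ltry oppr0 addye//.
  have [a0|a0|->] := ltgtP a 0%R.
  - by rewrite lt0_muley ?lte_fin// leNye.
  - by rewrite gt0_muley ?lte_fin// leye_eq.
  - by rewrite mul0e lee01.
rewrite hyperbola_itv// lebesgue_measure_itv/= lte_fin invr_gt0 c0.
by rewrite oppr0 adde0 -EFinM lee_fin ler_pdivrMr// mul1r.
Qed.

End hyperbola.

(** * The extremal function on the strip *)

Section extremal.
Context (R : realType) (n : nat) (Psi : R -> R).
Hypothesis Psi_young : young_function Psi.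

Definition strip (A : set R) (i : 'I_n.+1) : set R :=
  if i == ord0 then A else `]0, 1]%classic.

Lemma measurable_strip (A : set (measurableTypeR R)) : measurable A ->
  forall i, measurable (strip A i : set (measurableTypeR R)).
Proof. by move=> mA i; rewrite /strip; case: ifP. Qed.

Lemma lebesgueRn_strip (A : set (measurableTypeR R)) : measurable A ->
  lebesgueRn [set x : Rn R n.+1 | forall i, strip A i (tnth x i)] =
  @lebesgue_measure R A.
Proof.
move=> mA; rewrite lebesgueRn_tbox; last exact: measurable_strip.
rewrite big_ord_recl big1 ?mule1// => i _.
by rewrite /strip/= lebesgue_measure_itv/= lte01 oppr0 adde0.
Qed.

(** The first coordinate is kept positive because for [s <= 0] the set defining [young_inv] is
    unbounded and its [sup] is only a default value. *)
Definition extremal (x : lebesgueRn_type R n.+1) : R :=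
  if `[< forall i, strip `]0, +oo[%classic i (tnth (x : Rn R n.+1) i) >]
  then young_inv Psi (tnth (x : Rn R n.+1) ord0) else 0.

Lemma extremal_ge0 x : 0 <= extremal x.
Proof.
rewrite /extremal; case: asboolP => // /(_ ord0).
by rewrite /strip/= in_itv/= andbT; exact: young_inv_ge0.
Qed.

(** Off the strip [extremal] is 0, which does not exceed [t] as [0 <= t]; on the strip the first
    coordinate alone decides. *)
Lemma extremal_gt t : 0 <= t -> [set x | t < extremal x] =
  [set x : Rn R n.+1 |
    forall i, strip [set s | 0 < s /\ t < young_inv Psi s] i (tnth x i)].
Proof.
move=> t0; apply/seteqP; split=> x /=; rewrite /extremal.
  case: asboolP => [sx tx i|_]; last by rewrite ltNge t0.
  have := sx i; rewrite /strip; case: eqP => [->|//].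
  by rewrite /= in_itv/= andbT.
move=> sx; rewrite ifT; first by have [] := sx ord0.
apply/asboolP => i; have := sx i; rewrite /strip; case: eqP => [_|//].
by rewrite /= in_itv/= andbT => -[].
Qed.

Lemma measurable_extremal :
  measurable_fun [set: lebesgueRn_type R n.+1] extremal.
Proof.
apply: (measurability (@RGenOInfty.G R)); first exact: RGenOInfty.measurableE.
move=> _ [_ [a ->] <-]; rewrite setTI.
(* For a negative level the preimage is the whole space; otherwise it is a Borel box, hence
   Lebesgue-measurable. *)
have [a0|a0] := leP 0 a; last first.
  rewrite (_ : _ @^-1` _ = setT)//; apply/seteqP; split=> // x _ /=.
  by rewrite in_itv/= andbT (lt_le_trans a0)// extremal_ge0.
rewrite (_ : _ @^-1` _ = [set x | a < extremal x]); last first.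
  by apply/seteqP; split=> x /=; rewrite in_itv/= andbT.
rewrite extremal_gt//; apply: sub_caratheodory; apply: sub_sigma_algebra.
apply: measurable_tbox; apply: measurable_strip.
exact: measurable_young_inv_gt.
Qed.

Lemma lebesgueRn_extremal_gt t : 0 <= t ->
  lebesgueRn [set x | t < extremal x] =
  @lebesgue_measure R [set s | 0 < s /\ t < young_inv Psi s].
Proof.
move=> t0; rewrite extremal_gt// lebesgueRn_strip//.
exact: measurable_young_inv_gt.
Qed.

(** The value [b = 1] is admissible: by [lt_young_inv] the level set at [t] corresponds to a part of
    the set of [s > 0] with [s * Psi t < 1], whose length times [Psi t] is at most 1. *)
Lemma weak_orlicz_extremal : weak_orlicz n.+1 Psi extremal.
Proof.
split; first exact: measurable_extremal.
apply: (@le_lt_trans _ _ 1%:E); last exact: ltry.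
apply: ereal_inf_lbound; exists 1 => //; split=> //.
apply: ge_ereal_sup => _ [t t0 <-].
rewrite (_ : [set x | _] = [set x | t < extremal x]); last first.
  by apply/seteqP; split=> x /=; rewrite divr1 ger0_norm ?extremal_ge0.
have Pt0 : 0 <= Psi t by rewrite (young_ge0 Psi_young) ?ltW.
rewrite lebesgueRn_extremal_gt; last exact: ltW.
apply: (@le_trans _ _ ((Psi t)%:E *
    lebesgue_measure [set s : R | (0 < s /\ s * Psi t < 1)%R])%E); last first.
  by rewrite mule_hyperbola_le1.
rewrite lee_wpmul2l ?lee_fin// le_measure ?inE//.
- exact: measurable_young_inv_gt.
- exact: measurable_hyperbola.
- by move=> s [s0 ts]; split=> //; rewrite lt_young_inv// ltW.
Qed.

Lemma weak_orlicz_extremal_dominated (Phi : R -> R) : young_function Phi ->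
  weak_orlicz n.+1 Phi extremal ->
  exists2 C : R, 0 < C & forall t : R, 0 < t -> Phi t <= Psi (C * t).
Proof.
move=> Phi_young [_ /ereal_inf_lt[_ [b [b0 supb] <-] _]].
(* Here [b] is admissible for [extremal] and [Phi]. The factor 2 gives [b * t < 2 * b * t], which
   turns the non-strict bound of [young_inv_ge] into the strict one of the level set; any factor
   above 1 would do. *)
exists (2 * b); first by rewrite mulr_gt0.
move=> t t0; have bt0 : 0 < b * t by rewrite mulr_gt0.
have bt20 : 0 < 2 * b * t by rewrite -mulrA mulr_gt0.
have Pt0 : 0 <= Psi (2 * b * t) by rewrite (young_ge0 Psi_young) ?ltW.
(* It now suffices that the set of [s > 0] with [s * Psi (2 * b * t) < 1] lies in the one giving the
   level set of [extremal] at [b * t]. *)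
rewrite -mule_hyperbola_le1//.
apply: le_trans supb; apply: le_trans; last first.
  by apply: ereal_sup_ubound; exists t.
rewrite (_ : [set x | _] = [set x | b * t < extremal x]); last first.
  apply/seteqP; split=> x /=;
  by rewrite ger0_norm ?extremal_ge0// ltr_pdivlMr// mulrC.
rewrite lebesgueRn_extremal_gt; last exact: ltW.
rewrite lee_wpmul2l ?lee_fin ?(young_ge0 Phi_young (ltW t0))// le_measure ?inE//.
- exact: measurable_hyperbola.
- exact: measurable_young_inv_gt.
- move=> s [s0 st]; split=> //.
  apply: (@lt_le_trans _ _ (2 * b * t)).
    by rewrite -mulrA ltr_pMl// ltr1n.
  by rewrite young_inv_ge// ltW.
Qed.

End extremal.

(** * Comparison of the norms by scaling *)

Section weak_orlicz_norm.
Context (R : realType) (n : nat).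
Local Open Scope ereal_scope.
Implicit Types (Phi Psi : R -> R) (f : lebesgueRn_type R n -> R).

Lemma weak_orlicz_norm_ge0 Phi f : 0 <= weak_orlicz_norm Phi f.
Proof. by apply: le_ereal_inf_tmp => _ [b [b0 _] <-]; rewrite lee_fin ltW. Qed.

(** Exceeding [t] after division by [C * b] is exceeding [C * t] after division by [b], so every [b]
    admissible for [Psi] yields [C * b] admissible for [Phi]. *)
Lemma weak_orlicz_norm_le_scaled Phi Psi f (C : R) : (0 < C)%R ->
  (forall t, 0 < t -> Phi t <= Psi (C * t))%R ->
  weak_orlicz_norm Phi f <= C%:E * weak_orlicz_norm Psi f.
Proof.
move=> C0 PhiPsi; rewrite -lee_pdivrMl//.
apply: le_ereal_inf_tmp => _ [b [b0 supb] <-].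
rewrite lee_pdivrMl// -EFinM; apply: ereal_inf_lbound.
exists (C * b)%R => //; split; first by rewrite mulr_gt0.
apply: ge_ereal_sup => _ [t t0 <-]; apply: le_trans supb.
apply: (@le_trans _ _ ((Psi (C * t))%:E *
    lebesgueRn [set x | (C * t < `|f x| / b)%R])); last first.
  by apply: ereal_sup_ubound; exists (C * t)%R => //=; rewrite mulr_gt0.
rewrite (_ : [set x | (C * t < _)%R] = [set x | (t < `|f x| / (C * b))%R]).
  by rewrite lee_wpmul2r ?lee_fin ?PhiPsi.
apply/seteqP; split=> x /=;
  by rewrite !ltr_pdivlMr ?mulr_gt0// -mulrA mulrCA.
Qed.

End weak_orlicz_norm.

Theorem theorem3p3 (R : realType) (n : nat) (Phi Psi : R -> R)
    (n_ge1 : (1 <= n)%N)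
    (Phi_young : young_function Phi) (Psi_young : young_function Psi) :
  [<-> exists2 C : R, 0 < C & forall t : R, 0 < t -> Phi t <= Psi (C * t);
       weak_orlicz n Psi `<=` weak_orlicz n Phi;
       exists2 C : R, 0 < C &
         forall f : lebesgueRn_type R n -> R, weak_orlicz n Psi f ->
           (weak_orlicz_norm Phi f <= C%:E * weak_orlicz_norm Psi f)%E].
Proof.
have bounded C : 0 < C ->
    (forall f : lebesgueRn_type R n -> R, weak_orlicz n Psi f ->
      (weak_orlicz_norm Phi f <= C%:E * weak_orlicz_norm Psi f)%E) ->
    weak_orlicz n Psi `<=` weak_orlicz n Phi.
  move=> C0 PhiPsi f fPsi; split; first exact: fPsi.1.
  apply: le_lt_trans (PhiPsi _ fPsi) _.
  by rewrite lte_mul_pinfty ?lee_fin ?ltW//; exact: fPsi.2.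
have dominated : weak_orlicz n Psi `<=` weak_orlicz n Phi ->
    exists2 C : R, 0 < C & forall t : R, 0 < t -> Phi t <= Psi (C * t).
  (* A successor dimension supplies the first coordinate on which [extremal] depends. *)
  case: n n_ge1 {bounded} => // m _ PsiPhi.
  apply: (weak_orlicz_extremal_dominated (n := m)) => //.
  exact/PsiPhi/weak_orlicz_extremal.
(* The cycle to prove is (1) => (2) => (3) => (1), opposite to the natural one, so each arrow
   composes two of the implications at hand. *)
tfae.
- move=> [C C0 PhiPsi]; apply: (bounded C C0) => f _.
  exact: weak_orlicz_norm_le_scaled.
- move=> /dominated[C C0 PhiPsi]; exists C => // f _.
  exact: weak_orlicz_norm_le_scaled.
- by move=> [C C0 /(bounded C C0)/dominated].
Qed.
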